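(* Let $\Gamma=\bigcup_{r=1}^RC_r\subseteq\mathbb{R}^p$ with each $C_r$ convex polyhedral, let $g:\mathbb{R}^d\to\mathbb{R}^n$ be locally Lipschitz continuous and let $h:\mathbb{R}^d\to\mathbb{R}^m$, $\Phi_i:\mathbb{R}^d\to\mathbb{R}^p$ ($i=1,\dots,l$) be smooth. Assume that $p\le2$. Then, for the system $g(x)\le0$, $h(x)=0$, $\Phi_i(x)\in\Gamma$ ($i=1,\dots,l$), MPDC-PRCPLD implies MPDC-RCPLD: if MPDC-PRCPLD holds at a solution $\bar x$ of this system, then MPDC-RCPLD holds at $\bar x$ for this system.
   Context: Notation. $\partial$ is the limiting (Mordukhovich) subdifferential; $\widehat{\mathcal N}_C$ and $\mathcal{N}_C$ are the regular (Fréchet) and limiting (Mordukhovich) normal cones. Smooth means continuously differentiable. General disjunctive system: $g(x)\le0$, $h(x)=0$, $\Phi_i(x)\in\Gamma_i$ ($i=1,\dots,l$), with $g:\mathbb{R}^d\to\mathbb{R}^n$ locally Lipschitz, $h:\mathbb{R}^d\to\mathbb{R}^m$ and $\Phi_i:\mathbb{R}^d\to\mathbb{R}^{p_i}$ smooth, each $\Gamma_i$ a disjunctive set (a union of finitely many convex polyhedral sets), and solution set $\mathcal F$. $\nabla h_i$ is the gradient (column vector), $\nabla\Phi_i(x)$ the Jacobian matrix, and $\bar I_g:=\{i:g_i(\bar x)=0\}$. Generators. For finite sets $A^I,A^E$ of vectors put $\mathcal{G}(A^I,A^E):=\mathrm{cone}(A^I)+\mathrm{span}(A^E)$ (cone =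 generated convex cone; both are $\{0\}$ for the empty set). A generator of a convex polyhedral cone $D$ is a pair $(A^I,A^E)$ of finite disjoint sets, with the vectors in $A^E$ linearly independent, such that $D=\mathcal{G}(A^I,A^E)$ and $A^I\cup A^E$ has the minimal possible number of vectors (for $D=\{0\}$ one takes $A^I\cup A^E=\{0\}$). If $\Gamma$ is a disjunctive set and $x\in\Gamma$, then $\widehat{\mathcal N}_\Gamma(x)$ is a convex polyhedral cone; fix a generator $(\widehat A^I_\Gamma(x),\widehat A^E_\Gamma(x))$ of it (the same generator for equal cones). For $\bar y\in\Gamma$ there is $\delta>0$ (taken sufficiently small) with $\mathcal{N}_\Gamma(\bar y)=\bigcup_{x\in\mathbb{B}_\delta(\bar y)\cap\Gamma}\widehat{\mathcal N}_\Gamma(x)$, and one sets $A^I_\Gamma(\bar y):=\bigcup_{x\in\mathbb{B}_\delta(\bar y)\cap\Gamma}\widehat A^I_\Gamma(x)$, $A^E_\Gamma(\bar y):=\bigcup_{x\in\mathbb{B}_\delta(\bar y)\cap\Gamma}\widehat A^E_\Gamma(x)$ (finite sets). MPDC-RCPLD. A point $\bar x\in\mathcal F$ satisfies MPDC-RCPLD for the general disjunctive system if: (i) $\{\nabla h_i(x)\}_{i=1}^m$ has constant rank for all $x$ in a neighborhood of $\bar x$. (ii) Let $J\subseteq\{1,\dots,m\}$ be such that $\{\nabla h_i(\bar x)\}_{i\in J}$ is a basis of $\mathrm{span}\{\nabla h_i(\bar x)\}_{i=1}^m$. Whenever there exist $I\subseteq\bar I_g$, a nonzero vector $(\lambda^h,\lambda^g,\bar\eta)\in\mathbb{R}^m\times\mathbb{R}^n\times\prod_{i=1}^l\mathbb{R}^{p_i}$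 (with $\lambda^h_i=0$ for $i\notin J$, $\lambda^g_i=0$ for $i\notin I$) with $\lambda^g_i\ge0$, vectors $v_i\in\partial g_i(\bar x)$ $(i\in I)$ and $\bar\eta_i\in\mathcal{N}_{\Gamma_i}(\Phi_i(\bar x))$ $(i=1,\dots,l)$ such that $$0=\sum_{i\in I}\lambda_i^gv_i+\sum_{i\in J}\lambda_i^h\nabla h_i(\bar x)+\sum_{i=1}^l\nabla\Phi_i(\bar x)^T\bar\eta_i,$$ then for all sufficiently large $k$ the family $$\{v_i^k\}_{i\in I}\cup\{\nabla h_i(x^k)\}_{i\in J}\cup\bigcup_{i\in\{1,\dots,l\},\ \beta_i\in A_i^I\cup A_i^E}\{\nabla\Phi_i(x^k)^T\beta_i\}$$ is linearly dependent, for any sequences $x^k\to\bar x$, $x^k\ne\bar x$, $v_i^k\in\partial g_i(x^k)$, $v_i^k\to v_i$ $(i\in I)$, and any sets $A_i^I\subseteq A^I_{\Gamma_i}(\Phi_i(\bar x))$, $A_i^E\subseteq A^E_{\Gamma_i}(\Phi_i(\bar x))$ with $A_i^I\cup A_i^E$ linearly independent and $\bar\eta_i\in\mathcal{G}(A_i^I,A_i^E)\subseteq\mathcal{N}_{\Gamma_i}(\Phi_i(\bar x))$ if $\bar\eta_i\ne0$, and $A_i^I\cup A_i^E=\emptyset$ if $\bar\eta_i=0$. MPDC-PRCPLD (piecewise RCPLD). For the system $g(x)\le0$, $h(x)=0$, $\Phi_i(x)\in\Gamma=\bigcup_{r=1}^RC_r$ ($i=1,\dots,l$), it holds at a solution $\bar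 x$ if, for every partition of $\{1,\dots,l\}$ into sets $P_1,\dots,P_R$ (possibly empty) such that $\bar x$ solves the subsystem $g(x)\le0$, $h(x)=0$, $\Phi_i(x)\in C_r$ for $i\in P_r$, $r=1,\dots,R$, MPDC-RCPLD holds at $\bar x$ for that subsystem (viewed as a disjunctive system with $\Gamma_i=C_r$ for $i\in P_r$). *)

(* Defs.v *)
From HB Require Import structures.
From mathcomp Require Import all_boot all_order all_algebra.
From mathcomp Require Import finmap.
From mathcomp Require Import all_classical all_reals all_analysis.
Import Order.TTheory GRing.Theory Num.Theory.
Import numFieldNormedType.Exports.

Set Implicit Arguments.
Unset Strict Implicit.
Unset Printing Implicit Defensive.

Local Open Scope classical_set_scope.
Local Open Scope ring_scope.

(* Vectors of R^d are row vectors.  The norm of 'rV[R]_d is the sup norm;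
   every notion below depends only on the topology or is unchanged under an
   equivalent norm, so this agrees with the Euclidean norm. *)

Section VariationalAnalysis.
Variables (R : realType) (d : nat).
Implicit Types (x v : 'rV[R]_d) (C : set 'rV[R]_d) (f : 'rV[R]_d -> R).

Definition dotp (v w : 'rV[R]_d) : R := \sum_j v 0 j * w 0 j.

(* limsup_(y -> x, y in C) <v, y - x> / |y - x| <= 0 *)
Definition regular_normal_cone C x : set 'rV[R]_d :=
  [set v | C x /\ forall e : R, 0 < e ->
     \forall y \near within C (nbhs x), dotp v (y - x) <= e * `|y - x|].

Definition limiting_normal_cone C x : set 'rV[R]_d :=
  [set v | C x /\ exists xs vs : nat -> 'rV[R]_d,
     [/\ forall k, C (xs k),
         xs @ \oo --> x,
         forall k, regular_normal_cone C (xs k) (vs k)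
       & vs @ \oo --> v]].

(* liminf_(y -> x) (f y - f x - <v, y - x>) / |y - x| >= 0 *)
Definition regular_subdifferential f x : set 'rV[R]_d :=
  [set v | forall e : R, 0 < e ->
     \forall y \near x, - (e * `|y - x|) <= f y - f x - dotp v (y - x)].

Definition limiting_subdifferential f x : set 'rV[R]_d :=
  [set v | exists xs vs : nat -> 'rV[R]_d,
     [/\ xs @ \oo --> x,
         (fun k => f (xs k)) @ \oo --> f x,
         forall k, regular_subdifferential f (xs k) (vs k)
       & vs @ \oo --> v]].

Definition polyhedral C : Prop :=
  exists (k : nat) (A : 'I_k -> 'rV[R]_d) (b : 'I_k -> R),
    C = [set y | forall i, dotp (A i) y <= b i].

Definition disjunctive C : Prop :=
  exists (k : nat) (D : 'I_k -> set 'rV[R]_d),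
    (forall r, polyhedral (D r)) /\ C = \bigcup_r D r.

End VariationalAnalysis.

Section Smoothness.
Variables (R : realType) (d n : nat).
Implicit Types (F : 'rV[R]_d -> 'rV[R]_n) (x : 'rV[R]_d).

(* The usual Jacobian matrix, whose i-th row is the gradient of F_i; the
   library's [jacobian] acts on row vectors from the right and is its
   transpose.  The vector (nabla F x)^T eta is, as a row, eta *m nabla F x. *)
Definition nabla F x : 'M[R]_(n, d) := (jacobian F x)^T.

Definition grad F (i : 'I_n) x : 'rV[R]_d := row i (nabla F x).

Definition smooth F : Prop :=
  (forall x, differentiable F x) /\ continuous (nabla F).

Definition locally_lipschitz F : Prop :=
  forall x, exists2 U, nbhs x U & [lipschitz F y | y in U].

End Smoothness.

Section Generators.
Variables (R : realType) (p : nat).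
Local Notation vec := 'rV[R]_p.
Local Notation vecset := {fset 'rV[R]_p}.
Implicit Types (AI AE : vecset) (A B : vecset * vecset) (D : set vec).

Definition cone AI : set vec :=
  [set w | exists2 c : vec -> R,
     (forall a, 0 <= c a) & w = \sum_(a <- AI) c a *: a].

Definition GIE AI AE : set vec :=
  [set w | exists u v, [/\ cone AI u, v \in <<AE>>%VS & w = u + v]].

Definition generates D A : Prop :=
  [/\ [disjoint A.1 & A.2]%fset, free A.2 & D = GIE A.1 A.2].

Definition is_generator D A : Prop :=
  [/\ generates D A,
      D = [set 0] -> (A.1 `|` A.2 = [fset 0])%fset
    & D <> [set 0] -> forall B, generates D B ->
        (#|` (A.1 `|` A.2)%fset| <= #|` (B.1 `|` B.2)%fset|)%N].

End Generators.

(* A choice of generators.  It is a function of the cone, so that equal cones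
   receive the same generator, whatever sets they are normal to. *)
Definition generator_choice (R : realType) :=
  forall p : nat, set 'rV[R]_p -> {fset 'rV[R]_p} * {fset 'rV[R]_p}.

Definition is_generator_choice (R : realType) (gen : generator_choice R) : Prop :=
  forall (p : nat) (C : set 'rV[R]_p) (x : 'rV[R]_p), disjunctive C -> C x ->
    is_generator (regular_normal_cone C x) (gen p (regular_normal_cone C x)).

Section LimitingGenerators.
Variables (R : realType) (gen : generator_choice R) (p : nat).
Implicit Types (C : set 'rV[R]_p) (y : 'rV[R]_p).

(* For a disjunctive C the unions over ball y delta `&` C do not depend on
   delta once delta is small enough; [\forall delta \near 0^'+] selects this
   common value. *)
Definition gensI C y : set 'rV[R]_p :=
  [set a | \forall delta \near (0 : R)^'+,
     exists x, [/\ ball y delta x, C x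
                 & a \in (gen (regular_normal_cone C x)).1]].

Definition gensE C y : set 'rV[R]_p :=
  [set a | \forall delta \near (0 : R)^'+,
     exists x, [/\ ball y delta x, C x
                 & a \in (gen (regular_normal_cone C x)).2]].

End LimitingGenerators.

Section GeneralSystem.
Variables (R : realType) (gen : generator_choice R) (d n m l : nat).
Variables (p : 'I_l -> nat).
Variables (g : 'rV[R]_d -> 'rV[R]_n) (h : 'rV[R]_d -> 'rV[R]_m).
Variables (Phi : forall i : 'I_l, 'rV[R]_d -> 'rV[R]_(p i)).
Variables (Gamma : forall i : 'I_l, set 'rV[R]_(p i)).
Implicit Types (x : 'rV[R]_d) (I : {set 'I_n}) (J : {set 'I_m}).

Definition solution x : Prop :=
  [/\ forall i, g x 0 i <= 0, h x = 0 & forall i, Gamma (Phi i x)].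

(* [free] on a sequence is linear independence of the indexed family: a
   vector listed twice makes the family dependent. *)
Definition rcpld_family I (v : 'I_n -> 'rV[R]_d) J
    (A : forall i : 'I_l, {fset 'rV[R]_(p i)}) x : seq 'rV[R]_d :=
  [seq v i | i <- enum I] ++ [seq grad h i x | i <- enum J] ++
  flatten [seq [seq b *m nabla (Phi i) x | b <- enum_fset (A i)]
          | i <- enum 'I_l].

Definition MPDC_RCPLD x : Prop :=
  (\forall y \near x, \rank (nabla h y) = \rank (nabla h x))
  /\
  forall J, basis_of <<[seq grad h i x | i <- enum 'I_m]>>%VS
                     [seq grad h i x | i <- enum J] ->
  forall I (lh : 'rV[R]_m) (lg : 'rV[R]_n) (eta : forall i, 'rV[R]_(p i))
         (v : 'I_n -> 'rV[R]_d),
    (forall i, i \in I -> g x 0 i = 0) ->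
    ~ [/\ lh = 0, lg = 0 & forall i, eta i = 0] ->
    (forall i, i \notin J -> lh 0 i = 0) ->
    (forall i, i \notin I -> lg 0 i = 0) ->
    (forall i, 0 <= lg 0 i) ->
    (forall i, i \in I -> limiting_subdifferential (fun y => g y 0 i) x (v i)) ->
    (forall i, limiting_normal_cone (@Gamma i) (Phi i x) (eta i)) ->
    0 = \sum_(i in I) lg 0 i *: v i + \sum_(i in J) lh 0 i *: grad h i x
        + \sum_i eta i *m nabla (Phi i) x ->
  forall (xs : nat -> 'rV[R]_d) (vs : nat -> 'I_n -> 'rV[R]_d)
         (AI AE : forall i, {fset 'rV[R]_(p i)}),
    xs @ \oo --> x ->
    (forall k, xs k != x) ->
    (forall k i, i \in I ->
       limiting_subdifferential (fun y => g y 0 i) (xs k) (vs k i)) ->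
    (forall i, i \in I -> (fun k => vs k i) @ \oo --> v i) ->
    (forall i, [set` AI i] `<=` gensI gen (@Gamma i) (Phi i x)) ->
    (forall i, [set` AE i] `<=` gensE gen (@Gamma i) (Phi i x)) ->
    (forall i, eta i != 0 ->
       [/\ free (enum_fset (AI i `|` AE i)%fset),
           GIE (AI i) (AE i) (eta i)
         & GIE (AI i) (AE i) `<=` limiting_normal_cone (@Gamma i) (Phi i x)]) ->
    (forall i, eta i = 0 -> (AI i `|` AE i = fset0)%fset) ->
  \forall k \near \oo,
    ~~ free (rcpld_family I (vs k) J (fun i => (AI i `|` AE i)%fset) (xs k)).

End GeneralSystem.

Section PiecewiseRCPLD.
Variables (R : realType) (gen : generator_choice R) (d n m l p r : nat).
Variables (g : 'rV[R]_d -> 'rV[R]_n) (h : 'rV[R]_d -> 'rV[R]_m).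
Variables (Phi : 'I_l -> 'rV[R]_d -> 'rV[R]_p) (C : 'I_r -> set 'rV[R]_p).

(* A partition P_1, ..., P_r of the index set 'I_l into possibly empty sets is
   encoded by the map s sending i to the s with i in P_s. *)
Definition MPDC_PRCPLD (x : 'rV[R]_d) : Prop :=
  forall s : 'I_l -> 'I_r,
    solution g h Phi (fun i => C (s i)) x ->
    MPDC_RCPLD gen g h Phi (fun i => C (s i)) x.

End PiecewiseRCPLD.

(* Main.v *)
(* Linear dependence of the family in MPDC-RCPLD depends on the chosen vectors
   [A_i] only through their spans, monotonically.  So it suffices to find, for
   each [i] with nonzero multiplier [eta_i], a piece [C_s] at whose point
   [Phi_i x] the multiplier is generated by an independent set [B_i] of
   generators with [span B_i] inside [span A_i].

   The regular normal cone [K] of the union at [x'] is the intersection of the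
   regular normal cones [L_s] of the pieces containing [x'], and each piece has
   finitely many such cones, so one piece and one cone serve all
   neighbourhoods of [Phi_i x].  If [A_i] spans the space, Caratheodory's
   theorem in a single [L_s] is enough.  Otherwise [p = 2] and [A_i] is a single
   generator parallel to [eta_i].  If [eta_i] is not interior to [K], it is not
   interior to some [L_s], hence it is a multiple of one generator of [L_s].  If
   it is interior, minimality of the generator forces [K] to be a half-plane or
   the plane, hence equal to some [L_s], which then has the same generator. *)

Require Import Defs.
From HB Require Import structures.
From mathcomp Require Import all_boot all_order all_algebra.
From mathcomp Require Import finmap.
From mathcomp Require Import all_classical all_reals all_analysis.
From mathcomp Require Import ring lra.
Import Order.TTheory GRing.Theory Num.Theory.
Import numFieldNormedType.Exports.

Set Implicit Arguments.
Unset Strict Implicit.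
Unset Printing Implicit Defensive.

Local Open Scope classical_set_scope.
Local Open Scope ring_scope.

(** * Linear independence of families under shrinking of spans *)

Section Freeness.
Variables (K : fieldType) (V W : vectType K).

Lemma free_uniq_sum (X : seq V) : uniq X ->
  (forall k : V -> K, \sum_(a <- X) k a *: a = 0 -> {in X, k =1 fun=> 0}) ->
  free X.
Proof.
move=> uX indep; change (is_true (free (in_tuple X))); apply/freeP => k k0 i.
pose k' (a : V) := oapp k 0 (insub (index a X)).
have k'E (j : 'I_(size X)) : k' X`_j = k j.
  by rewrite /k' index_uniq // valK.
rewrite -k'E; apply: indep; last exact: mem_nth.
by rewrite (big_nth 0) big_mkord -[RHS]k0; apply: eq_bigr => j _; rewrite k'E.
Qed.

(** Freeness of the image of [Y] makes [f] injective on the span of [Y] by a dimension count, hence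
    on the smaller span of [X]. *)
Lemma free_map_subspan (f : 'Hom(V, W)) (X Y : seq V) :
  free X -> (<<X>> <= <<Y>>)%VS -> free (map f Y) -> free (map f X).
Proof.
move=> freeX sXY /eqP freefY.
have kerY : (<<Y>> :&: lker f = 0)%VS.
  apply/eqP; rewrite -dimv_eq0 -leqn0 -(leq_add2r (size (map f Y))) add0n.
  rewrite -{1}freefY -limg_span limg_ker_dim size_map; exact: dim_span.
have kerX : (<<X>> :&: lker f = 0)%VS.
  by apply/eqP; rewrite -subv0 -kerY capvS.
by rewrite /free -limg_span limg_dim_eq // size_map; exact: freeX.
Qed.

Lemma free_cat_subspan (X X' Y Y' : seq V) :
  free X' -> free Y' -> (<<X'>> <= <<X>>)%VS -> (<<Y'>> <= <<Y>>)%VS ->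
  free (X ++ Y) -> free (X' ++ Y').
Proof.
move=> fX' fY' sX sY; rewrite !cat_free fX' fY' => /and3P[_ _ /directv_addP dXY].
by apply/directv_addP/eqP; rewrite -subv0 -dXY capvS.
Qed.

End Freeness.

Lemma free_flatten_subspan (K : fieldType) (V : vectType K) (I : Type)
    (U : I -> vectType K) (f : forall i, 'Hom(U i, V)) (A B : forall i, seq (U i))
    (s : seq I) :
  (forall i, free (A i)) -> (forall i, (<<A i>> <= <<B i>>)%VS) ->
  free (flatten [seq map (f i) (B i) | i <- s]) ->
  free (flatten [seq map (f i) (A i) | i <- s]) /\
  (<<flatten [seq map (f i) (A i) | i <- s]>> <=
    <<flatten [seq map (f i) (B i) | i <- s]>>)%VS.
Proof.
move=> freeA sAB; elim: s => [|i s IHs] /=; first by [].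
move=> fB; have := fB; rewrite cat_free => /and3P[fBi /IHs[fAs sABs] _].
have sABi : (<<map (f i) (A i)>> <= <<map (f i) (B i)>>)%VS.
  by rewrite -!limg_span limgS.
split; last by rewrite !span_cat addvS.
apply: free_cat_subspan fB => //.
exact: free_map_subspan fBi.
Qed.

Section Families.
Variables (R : realType) (d n m l : nat) (p : 'I_l -> nat).
Variables (h : 'rV[R]_d -> 'rV[R]_m).
Variables (Phi : forall i : 'I_l, 'rV[R]_d -> 'rV[R]_(p i)).

(** Used in the contrapositive: dependence of the family built on smaller spans passes to the family
    built on larger ones. *)
Lemma rcpld_family_subspan (I : {set 'I_n}) (v : 'I_n -> 'rV[R]_d)
    (J : {set 'I_m}) (A B : forall i : 'I_l, {fset 'rV[R]_(p i)})
    (x : 'rV[R]_d) :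
  (forall i, free (enum_fset (A i))) ->
  (forall i, (<<enum_fset (A i)>> <= <<enum_fset (B i)>>)%VS) ->
  free (rcpld_family h Phi I v J B x) -> free (rcpld_family h Phi I v J A x).
Proof.
move=> freeA sAB; rewrite /rcpld_family !catA.
pose f i : 'Hom('rV[R]_(p i), 'rV[R]_d) := linfun (mulmxr (nabla (Phi i) x)).
have fE (D : forall i : 'I_l, {fset 'rV[R]_(p i)}) :
    [seq [seq b *m nabla (Phi i) x | b <- enum_fset (D i)] | i <- enum 'I_l]
    = [seq map (f i) (enum_fset (D i)) | i <- enum 'I_l].
  by apply: eq_map => i; apply: eq_map => b; rewrite lfunE.
rewrite !fE => fB; have := fB; rewrite cat_free => /and3P[fvh fflat _].
have [fA sA] := @free_flatten_subspan _ _ _ _ f _ _ _ freeA sAB fflat.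
exact: free_cat_subspan fB.
Qed.

End Families.

(** * Thresholds common to finitely many conditions; sums over finite sets *)

Lemma uniform_pos (R : realFieldType) (I : eqType) (s : seq I) (P : I -> R -> Prop) :
  (forall i t u, P i t -> 0 < u <= t -> P i u) ->
  {in s, forall i, exists2 t, 0 < t & P i t} ->
  exists2 t, 0 < t & {in s, forall i, P i t}.
Proof.
move=> Pdown; elim: s => [|i s IHs] Ps; first by exists 1.
have [t t0 Pt] : exists2 t, 0 < t & {in s, forall i, P i t}.
  by apply: IHs => j js; apply: Ps; rewrite inE js orbT.
have [u u0 Pu] := Ps i (mem_head _ _).
have m0 : 0 < Num.min t u by rewrite lt_min t0 u0.
exists (Num.min t u) => // j; rewrite inE => /predU1P[->|js].
- by apply: Pdown Pu _; rewrite m0 ge_min lexx orbT.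
- by apply: Pdown (Pt _ js) _; rewrite m0 ge_min lexx.
Qed.

(** Failure passes to smaller thresholds; if every [i] failed somewhere, all would fail at a common
    threshold. *)
Lemma pigeonhole_pos (R : realFieldType) (T : finType) (P : T -> R -> Prop) :
  (forall i t u, P i t -> t <= u -> P i u) ->
  (forall t, 0 < t -> exists i, P i t) ->
  exists i, forall t, 0 < t -> P i t.
Proof.
move=> Pup Pex; apply: contrapT => /forallNP nP.
have [t t0 nPt] : exists2 t, 0 < t & {in enum T, forall i, ~ P i t}.
  apply: uniform_pos => [i t u nPt /andP[_ ut] Pu|i _]; first exact/nPt/(Pup _ u).
  by have /existsNP[t /not_implyP[t0 nPt]] := nP i; exists t.
by have [i Pi] := Pex t t0; apply: (nPt i) => //; rewrite mem_enum.
Qed.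

Lemma span_sum_uniq (K : fieldType) (V : vectType K) (X : seq V) v :
  uniq X -> v \in <<X>>%VS -> exists k : V -> K, v = \sum_(a <- X) k a *: a.
Proof.
move=> uX /(@coord_span _ _ _ (in_tuple X)) vE.
(* Off [X] the index is out of range and the coefficient takes the default 0. *)
exists (fun a => oapp (fun i => coord (in_tuple X) i v) 0 (insub (index a X))).
rewrite {1}vE (big_nth 0) big_mkord; apply: eq_bigr => i _.
by rewrite index_uniq // valK.
Qed.

Lemma fset1_seq (T : choiceType) (a : T) : [fset a]%fset = [:: a] :> seq T.
Proof.
by apply: perm_small_eq => //; apply: uniq_perm => // b; rewrite !inE.
Qed.

Lemma fset0_seq (T : choiceType) : (fset0 : {fset T}) = [::] :> seq T.
Proof. exact/size0nil/cardfs0. Qed.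

(** * Finitely generated cones, their interiors and their minimal generators *)

Section Cones.
Variables (R : realType) (p : nat).
Local Notation V := 'rV[R]_p.
Local Notation vecset := {fset 'rV[R]_p}.
Implicit Types (K L : set V) (S AI AE : vecset).

Definition conic K : Prop := forall u v s t,
  K u -> K v -> 0 <= s -> 0 <= t -> K (s *: u + t *: v).

Lemma conicZ K u s : conic K -> K u -> 0 <= s -> K (s *: u).
Proof.
by move=> cK Ku s0; have := cK u u s 0 Ku Ku s0 (lexx 0); rewrite scale0r addr0.
Qed.

Lemma conicD K u v : conic K -> K u -> K v -> K (u + v).
Proof.
by move=> cK Ku Kv; have := cK u v 1 1 Ku Kv ler01 ler01; rewrite !scale1r.
Qed.

Lemma conic_GIE AI AE : conic (GIE AI AE).
Proof.
move=> _ _ s t [_ [v1 [[c1 c10 ->] v1E ->]]] [_ [v2 [[c2 c20 ->] v2E ->]]] s0 t0.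
exists (\sum_(a <- AI) (s * c1 a + t * c2 a) *: a), (s *: v1 + t *: v2); split.
- by exists (fun a => s * c1 a + t * c2 a) => // a; rewrite addr_ge0 ?mulr_ge0.
- by rewrite rpredD ?rpredZ.
rewrite !scalerDr !scaler_sumr addrACA -big_split /=; congr (_ + _).
by apply: eq_bigr => a _; rewrite !scalerA -scalerDl.
Qed.

Lemma GIE_span AI AE v : v \in <<AE>>%VS -> GIE AI AE v.
Proof.
move=> vE; exists 0, v; split=> //; last by rewrite add0r.
by exists (fun=> 0) => //; rewrite big1 // => a _; rewrite scale0r.
Qed.

Lemma GIE_pos_sum S AI AE (c : V -> R) v : (S `<=` AI)%fset ->
  {in S, forall a, 0 <= c a} -> v \in <<AE>>%VS ->
  GIE AI AE (\sum_(a <- S) c a *: a + v).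
Proof.
move=> SAI c0 vE; exists (\sum_(a <- S) c a *: a), v; split=> //.
exists (fun a => if a \in S then c a else 0).
  by move=> a; case: ifP => // /c0.
under [RHS]eq_bigr => a _ do rewrite (fun_if (fun c => c *: a)) scale0r.
rewrite -big_mkcond -big_filter; apply: perm_big; apply: uniq_perm.
- exact: fset_uniq.
- by rewrite filter_uniq ?fset_uniq.
move=> a; rewrite mem_filter; case aS: (a \in S) => //=.
by rewrite (fsubsetP SAI).
Qed.

Lemma GIE_mem AI AE a : a \in AI -> GIE AI AE a.
Proof.
move=> aI; have := @GIE_pos_sum [fset a]%fset AI AE (fun=> 1) 0.
by rewrite big_seq_fset1 scale1r addr0; apply; rewrite ?mem0v ?fsub1set.
Qed.

Lemma GIE_min AI AE K : conic K -> {in AI, forall a, K a} ->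
  (forall v, v \in <<AE>>%VS -> K v) -> GIE AI AE `<=` K.
Proof.
move=> cK KI KE _ [_ [v [[c c0 ->] vE ->]]]; rewrite big_seq.
elim/big_rec: _ => [|a w aI Kw]; first by rewrite add0r; exact: KE.
by rewrite -addrA; apply: conicD => //; apply: conicZ => //; exact: KI.
Qed.

Lemma GIE_subset S S' AI AE : (S `<=` AI)%fset -> (S' `<=` AE)%fset ->
  GIE S S' `<=` GIE AI AE.
Proof.
move=> SAI SAE; apply: GIE_min; first exact: conic_GIE.
  by move=> a aS; apply/GIE_mem/(fsubsetP SAI).
by move=> v vS; apply: GIE_span; apply: subvP vS; apply: sub_span; apply/fsubsetP.
Qed.

Lemma GIE_sub_span AI AE w : GIE AI AE w -> w \in <<enum_fset (AI `|` AE)%fset>>%VS.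
Proof.
move=> [_ [v [[c _ ->] vE ->]]]; rewrite rpredD //.
  rewrite big_seq; apply: rpred_sum => a aI; apply/rpredZ/memv_span.
  by rewrite inE aI.
by apply: subvP vE; apply: sub_span => a aE; rewrite inE aE orbT.
Qed.

(** The hypothesis on [k] is independence of [S] modulo the span of [AE]; it rules out common
    vectors, so the union is a concatenation up to order. *)
Lemma free_fsetU S AE : free (enum_fset AE) ->
  (forall k : V -> R, \sum_(a <- S) k a *: a \in <<enum_fset AE>>%VS ->
    {in S, k =1 fun=> 0}) -> free (enum_fset (S `|` AE)%fset).
Proof.
move=> fE indep.
have dSE a : a \in S -> a \notin AE.
  move=> aS; apply/negP => aE.
  have /(_ a aS) : {in S, (fun b => (b == a)%:R : R) =1 fun=> 0}.
    apply: indep; rewrite (big_fsetD1 a) //= eqxx scale1r big1_fset ?addr0 ?memv_span //.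
    by move=> b; rewrite !inE => /andP[/negPf-> _] _; rewrite scale0r.
  by rewrite eqxx => /eqP; rewrite oner_eq0.
rewrite (@perm_free _ _ _ (enum_fset S ++ enum_fset AE)).
  rewrite cat_free fE /=.
  have fS : free (enum_fset S).
    apply: free_uniq_sum => [|k k0]; first exact: fset_uniq.
    by apply: indep; rewrite k0 mem0v.
  rewrite fS; apply/directv_addP/eqP; rewrite -subv0; apply/subvP => w.
  rewrite memv_cap => /andP[/span_sum_uniq -/(_ (fset_uniq _))[k ->] /indep k0].
  rewrite big_seq big1 ?mem0v // => a aS; by rewrite k0 // scale0r.
apply: uniq_perm; rewrite ?cat_uniq ?fset_uniq //=.
  by rewrite andbT; apply/hasPn => a aE; apply/negP => /dSE; rewrite aE.
by move=> a; rewrite mem_cat inE.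
Qed.

(* Caratheodory's theorem modulo the lineality space spanned by [AE]. *)
Lemma GIE_free_subset AI AE w : free (enum_fset AE) -> GIE AI AE w ->
  exists S (c : V -> R) v, [/\ (S `<=` AI)%fset, {in S, forall a, 0 < c a},
    v \in <<AE>>%VS, w = \sum_(a <- S) c a *: a + v
    & free (enum_fset (S `|` AE)%fset)].
Proof.
move=> fE [_ [v0 [[c0 c00 ->] v0E ->]]].
have [N] := ubnP #|` AI|.
have : {in AI, forall a, 0 <= c0 a} by move=> a _; exact: c00.
move: c0 {c00} v0 v0E; elim: N AI => // N IHN AI c v vE c0 leN.
(* A generator with coefficient zero can be removed, which lowers the cardinality for the
   induction. *)
have drop a v' c' : a \in AI -> v' \in <<AE>>%VS ->
    {in AI, forall b, 0 <= c' b} -> c' a = 0 ->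
    \sum_(a <- AI) c a *: a + v = \sum_(a <- AI) c' a *: a + v' ->
  exists S (c1 : V -> R) v1, [/\ (S `<=` AI)%fset, {in S, forall a, 0 < c1 a},
    v1 \in <<AE>>%VS, \sum_(a <- AI) c a *: a + v = \sum_(a <- S) c1 a *: a + v1
    & free (enum_fset (S `|` AE)%fset)].
  move=> aI v'E c'0 c'a ->; rewrite (big_fsetD1 a) //= c'a scale0r add0r.
  have [||S [c1 [v1 [SI c1p v1E -> fS]]]] := IHN (AI `\ a)%fset c' v' v'E.
  - by move=> b; rewrite !inE => /andP[_ /c'0].
  - by move: leN; rewrite (cardfsD1 a) aI add1n ltnS.
  by exists S, c1, v1; split=> //; exact: fsubset_trans SI (fsubD1set _ _).
have [[a aI ca0]|cpos] := pselect (exists2 a, a \in AI & c a = 0).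
  exact: (drop a v c).
have [[k [kE kn0]]|indep] := pselect (exists k : V -> R,
    \sum_(a <- AI) k a *: a \in <<enum_fset AE>>%VS /\ ~ {in AI, k =1 fun=> 0});
    last first.
  exists AI, c, v; split=> //.
    move=> a aI; rewrite lt_neqAle c0 // andbT eq_sym; apply/eqP => ca0.
    by apply: cpos; exists a.
  by apply: free_fsetU => // k kE; apply: contrapT => kn0; apply: indep; exists k.
(* Up to the sign of [k], some coefficient of the relation is positive. *)
have {k kE kn0} [k [kE [a aI ka]]] : exists k : V -> R,
    \sum_(a <- AI) k a *: a \in <<enum_fset AE>>%VS /\ exists2 a, a \in AI & 0 < k a.
  have /existsNP[a /not_implyP[aI /eqP ka]] := kn0.
  have [ka0|ka0] := ltP 0 (k a); first by exists k; split=> //; exists a.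
  exists (fun a => - k a); split.
    have -> : \sum_(a <- AI) - k a *: a = - \sum_(a <- AI) k a *: a.
      by rewrite -sumrN; apply: eq_bigr => b _; rewrite scaleNr.
    by rewrite rpredN.
  by exists a => //; rewrite oppr_gt0 lt_neqAle ka.
(* Ratio test: subtracting [t] times the relation, with [t] the least ratio, keeps all coefficients
   nonnegative and cancels that of [b]; the lineality part [v] absorbs the change. *)
pose F (b : AI) := c (val b) / k (val b).
have [b kb bmin] := @arg_minP _ _ _ [` aI]%fset (fun b : AI => 0 < k (val b)) F ka.
pose t := F b.
have t0 : 0 <= t by apply: divr_ge0; [exact/c0/valP|exact/ltW].
apply: (drop (val b) (v + t *: \sum_(a <- AI) k a *: a) (fun a => c a - t * k a)).
- exact: valP.
- by rewrite rpredD ?rpredZ.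
- move=> e eI; rewrite subr_ge0; have [ke|ke] := ltP 0 (k e).
    by rewrite -ler_pdivlMr //; exact: (bmin [` eI]%fset).
  by apply: le_trans (c0 _ eI); rewrite mulr_ge0_le0.
- by rewrite /t /F mulfVK ?subrr // gt_eqF.
rewrite addrCA addrC; congr (_ + _); rewrite scaler_sumr -big_split /=.
by apply: eq_bigr => e _; rewrite scalerA -scalerDl; congr (_ *: _); ring.
Qed.

(** On convex sets this is the algebraic interior: one [t] per direction is enough, as smaller ones
    follow by convexity. *)
Definition core K a : Prop := forall z, exists2 t : R, 0 < t & K (a + t *: z).

Lemma core_mem K a : core K a -> K a.
Proof. by move=> /(_ 0)[t _]; rewrite scaler0 addr0. Qed.

Lemma core_subset K L a : K `<=` L -> core K a -> core L a.
Proof. by move=> KL Ka z; have [t t0 /KL] := Ka z; exists t. Qed.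

(** Any [z] is a positive multiple of [(a + t *: z) + (- a)]. *)
Lemma core_full K a : conic K -> core K a -> K (- a) -> K = setT.
Proof.
move=> cK Ka KNa; apply/seteqP; split=> // z _; have [t t0 Kt] := Ka z.
have ti : 0 <= t^-1 by rewrite invr_ge0 ltW.
have := cK _ _ _ _ Kt KNa ti ti.
by rewrite -scalerDr addrAC subrr add0r scalerA mulVf ?gt_eqF // scale1r.
Qed.

Lemma core_bigcap (T : finType) (D : T -> Prop) (L : T -> set V) a :
  (forall s, D s -> conic (L s)) -> (forall s, D s -> core (L s) a) ->
  core [set v | forall s, D s -> L s v] a.
Proof.
move=> cL La z.
have [||t t0 Lt] := @uniform_pos R T (enum T) (fun s t => D s -> L s (a + t *: z)).
- move=> s t u Lt /andP[u0 ut] Ds.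
  have t0 : 0 < t by exact: lt_le_trans ut.
  have -> : a + u *: z = (1 - u / t) *: a + (u / t) *: (a + t *: z).
    rewrite scalerDr addrA -scalerDl subrK scale1r scalerA.
    by rewrite divfK // gt_eqF.
  apply: (cL s Ds); [exact: core_mem (La s Ds)|exact: Lt| |].
    by rewrite subr_ge0 ler_pdivrMr // mul1r.
  by rewrite divr_ge0 // ltW.
- move=> s _; have [Ds|nDs] := pselect (D s); last by exists 1.
  by have [t t0 Lt] := La s Ds z; exists t.
by exists t => // s; apply: Lt; rewrite mem_enum.
Qed.

(** A short displacement along [z] keeps the positive coefficients on [S] nonnegative, and the part
    in the span of [AE] carries no sign. *)
Lemma core_GIE S AE (c : V -> R) v : {in S, forall a, 0 < c a} ->
  v \in <<AE>>%VS -> <<enum_fset (S `|` AE)%fset>>%VS = fullv ->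
  core (GIE S AE) (\sum_(a <- S) c a *: a + v).
Proof.
move=> c0 vE full z.
have : z \in (<<enum_fset S>> + <<enum_fset AE>>)%VS.
  rewrite -span_cat; apply: subvP (memvf z); rewrite -full; apply: sub_span => a.
  by rewrite mem_cat inE.
move=> /memv_addP[_ /span_sum_uniq -/(_ (fset_uniq _))[k ->] [e eE ->]].
(* The conjunct [0 <= c a] lets the condition pass to smaller [t] when [k a] is nonnegative. *)
have [||t t0 ct] := @uniform_pos R _ S (fun a t => 0 <= c a + t * k a /\ 0 <= c a).
- move=> a t u [ct ca] /andP[u0 ut]; split=> //.
  have [ka|/ltW ka] := leP 0 (k a); first by rewrite addr_ge0 // mulr_ge0 // ltW.
  by apply: le_trans ct _; rewrite lerD2l ler_wnM2r.
- move=> a aS; have ca := c0 a aS; exists (c a / (`|k a| + 1)).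
    by rewrite divr_gt0 // ltr_wpDl.
  split; last exact: ltW.
  have k1 : 0 < `|k a| + 1 by rewrite ltr_wpDl.
  have -> : c a + c a / (`|k a| + 1) * k a = c a / (`|k a| + 1) * (`|k a| + 1 + k a).
    by rewrite [RHS]mulrDr divfK ?gt_eqF.
  rewrite mulr_ge0 //; first by rewrite divr_ge0 // ltW.
  by have := ler_norm (- k a); rewrite normrN; lra.
exists t => //.
have -> : \sum_(a <- S) c a *: a + v + t *: (\sum_(a <- S) k a *: a + e)
    = \sum_(a <- S) (c a + t * k a) *: a + (v + t *: e).
  rewrite scalerDr addrACA scaler_sumr -big_split; congr (_ + _).
  by apply: eq_bigr => a _; rewrite /= scalerA -scalerDl.
by apply: GIE_pos_sum => [|a /ct[]|] //; rewrite rpredD ?rpredZ.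
Qed.

Definition generated_by_one (A : vecset * vecset) w : Prop :=
  (exists2 a, a \in A.1 & exists2 c : R, 0 < c & w = c *: a) \/
  (exists2 a, a \in A.2 & exists2 c : R, c != 0 & w = c *: a).

(** Caratheodory's theorem gives an independent union of some [S] and [A.2] that carries [w]. With
    [p] vectors it would span and make [w] interior; so for [p <= 2] it has at most one. *)
Lemma noncore_generated_by_one (A : vecset * vecset) w : (p <= 2)%N ->
  free (enum_fset A.2) -> GIE A.1 A.2 w -> ~ core (GIE A.1 A.2) w -> w != 0 ->
  generated_by_one A w.
Proof.
move=> p2 fE Gw ncw w0; have [S [c [v [SA c0 vE wE fS]]]] := GIE_free_subset fE Gw.
have wS : w \in <<enum_fset (S `|` A.2)%fset>>%VS.
  apply: (@GIE_sub_span S A.2); rewrite wE; apply: GIE_pos_sum => // a /c0.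
  exact: ltW.
have dimS : \dim <<enum_fset (S `|` A.2)%fset>>%VS = #|` (S `|` A.2)%fset|.
  exact/eqP.
have ltp : (#|` (S `|` A.2)%fset| < p)%N.
  rewrite ltnNge; apply/negP => lep; apply: ncw; rewrite wE.
  apply: (@core_subset (GIE S A.2)); first exact: GIE_subset.
  apply: core_GIE => //; apply/eqP; rewrite eqEdim subvf dimvf dimS.
  by rewrite dim_matrix mul1r.
have : (#|` (S `|` A.2)%fset| <= 1)%N by rewrite -ltnS (leq_trans ltp).
rewrite leq_eqVlt ltnS leqn0 => /orP[/cardfs1P[a SEa]|/eqP S0]; last first.
  by move: w0; rewrite -memv0 (_ : 0%VS = <<enum_fset (S `|` A.2)%fset>>%VS) ?wS //;
    apply/esym/eqP; rewrite -dimv_eq0 dimS S0.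
have aP b : b \in S \/ b \in A.2 -> b = a.
  move=> SAb; have : b \in (S `|` A.2)%fset by rewrite inE; apply/orP.
  by rewrite SEa inE => /eqP.
have [aE|aE] := boolP (a \in A.2).
  right; exists a => //; move: wS; rewrite SEa fset1_seq.
  rewrite span_seq1 => /vlineP[k wk]; exists k => //.
  by apply: contraNneq w0 => k0; rewrite wk k0 scale0r.
have E0 : A.2 = fset0.
  by apply/fsetP => b; rewrite inE; apply/negP => bE; move: aE; rewrite -(aP b) ?bE //; right.
have Sa : S = [fset a]%fset by rewrite -SEa E0 fsetU0.
left; exists a; first by apply: (fsubsetP SA); rewrite Sa inE.
exists (c a); first by apply: c0; rewrite Sa inE.
move: vE; rewrite wE Sa big_seq_fset1 E0 fset0_seq.
by rewrite span_nil memv0 => /eqP ->; rewrite addr0.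
Qed.

(** Otherwise deleting [a] would give a smaller generating pair, against minimality. The zero cone
    is excluded, as its conventional generator is the redundant vector 0. *)
Lemma generator_irredundant K (A : vecset * vecset) a :
  is_generator K A -> K <> [set 0] -> a \in A.1 -> ~ GIE (A.1 `\ a)%fset A.2 a.
Proof.
move=> [[dA fA KE] _ minA] /minA{}minA aA1 aG.
have aA2 : a \notin A.2 by exact: (fdisjointP dA).
have /minA : generates K ((A.1 `\ a)%fset, A.2).
  split=> //=; first by apply: fdisjointWl dA; exact: fsubD1set.
  rewrite KE; apply/seteqP; split; last exact/GIE_subset/fsubset_refl/fsubD1set.
  apply: GIE_min; [exact: conic_GIE| |by move=> v; exact: GIE_span].
  move=> b bA1; have [->//|ba] := eqVneq b a.
  by apply: GIE_mem; rewrite !inE ba.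
have -> : ((A.1 `\ a) `|` A.2 = (A.1 `|` A.2) `\ a)%fset.
  apply/fsetP => b; rewrite !inE; have [->|] //= := eqVneq b a.
  by rewrite (negPf aA2).
by rewrite (cardfsD1 a (A.1 `|` A.2)%fset) inE aA1 add1n ltnn.
Qed.

(* Otherwise [a] would be a nonnegative combination of the other generators:
   [a - t b] lies in [K] for a small [t > 0]. *)
Lemma core_generator_line K (A : vecset * vecset) a :
  is_generator K A -> K <> [set 0] -> a \in A.1 -> core K a -> <[a]>%VS != fullv ->
  exists b, [/\ b \notin <[a]>%VS, K b & K (- b)].
Proof.
move=> genA Kn0 aA1 aK an; have irr := generator_irredundant genA Kn0 aA1.
case: genA => [[dA fA KE] _ _].
have [[v vE va]|noE] := pselect (exists2 v, v \in <<A.2>>%VS & v \notin <[a]>%VS).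
  by exists v; split=> //; rewrite KE; apply: GIE_span; rewrite ?rpredN.
(* If all generators lay on the line of [a], so would [K], and [a] could not be interior. *)
have [[b bA1 ba]|noI] := pselect (exists2 b, b \in A.1 & b \notin <[a]>%VS); last first.
  case/negP: an; rewrite eqEsubv subvf; apply/subvP => z _.
  have Ka : K `<=` [set v | v \in <[a]>%VS].
    rewrite KE; apply: GIE_min => [u v s t /= ua va _ _|b bA1|v vE] /=.
    - by rewrite rpredD ?rpredZ.
    - by apply: contrapT => /negP ba; apply: noI; exists b.
    - by apply: contrapT => /negP va; apply: noE; exists v.
  have [t t0 /Ka /= ta] := aK z.
  have : t *: z \in <[a]>%VS by rewrite -[t *: z](addKr a) rpredD ?rpredN ?memv_line.
  by rewrite rpredZeq (gt_eqF t0).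
have Kb : K b by rewrite KE; exact: GIE_mem.
exists b; split=> //; have [t t0] := aK (- b).
rewrite {1}KE => -[_ [v [[c c0 ->] vE]]].
rewrite (big_fsetD1 a) //= -addrA; set m := _ + v => tE.
have mG : GIE (A.1 `\ a)%fset A.2 m by exact: GIE_pos_sum.
have bG : GIE (A.1 `\ a)%fset A.2 b.
  apply: GIE_mem; rewrite !inE bA1 andbT; apply: contraNneq ba => ->.
  exact: memv_line.
have cG := @conic_GIE (A.1 `\ a)%fset A.2.
have mE : m = a - t *: b - c a *: a by rewrite scalerN in tE; rewrite tE addrAC subrr add0r.
(* The relation reads [a - t *: b = c a *: a + m] with [m] generated without [a]. If [c a < 1] it
   makes [a] redundant; otherwise it shows that [- b] is in [K]. *)
have [ca1|ca1] := ltP (c a) 1.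
  case: irr.
  have aE : a = (1 - c a)^-1 *: (m + t *: b).
    have -> : m + t *: b = (1 - c a) *: a by rewrite mE addrAC subrK scalerBl scale1r.
    by rewrite scalerA mulVf ?scale1r // gt_eqF // subr_gt0.
  rewrite [X in GIE _ _ X]aE; apply: (conicZ cG); last by rewrite invr_ge0 subr_ge0 ltW.
  by apply: (conicD cG mG); apply: (conicZ cG bG); exact: ltW.
have -> : - b = t^-1 *: ((c a - 1) *: a + m).
  have -> : (c a - 1) *: a + m = - (t *: b).
    rewrite mE scalerBl scale1r [a - t *: b - _]addrAC addrA.
    by rewrite -[a - c a *: a]opprB subrr add0r.
  by rewrite scalerN scalerA mulVf ?scale1r ?gt_eqF.
have cK : conic K by rewrite KE; exact: conic_GIE.
apply: conicZ => //; last by rewrite invr_ge0 ltW.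
apply: conicD => //; first by apply: conicZ => //; [exact: core_mem|rewrite subr_ge0].
by rewrite KE; apply: GIE_subset mG; [exact: fsubD1set|exact: fsubset_refl].
Qed.

(** [G] sees only the cone, so an equality [L s = K] carries the generator over; this settles the
    case of [w] interior to [K]. *)
Lemma generated_by_one_bigcap (T : finType) (D : T -> Prop) (L : T -> set V)
    (K : set V) (G : set V -> vecset * vecset) w :
  (p <= 2)%N -> (exists s, D s) -> K = [set v | forall s, D s -> L s v] ->
  is_generator K (G K) -> (forall s, D s -> is_generator (L s) (G (L s))) ->
  w != 0 -> <[w]>%VS != fullv -> generated_by_one (G K) w ->
  exists2 s, D s & generated_by_one (G (L s)) w.
Proof.
move=> p2 [s0 Ds0] KL genK genL w0 wn wG.
have KE : K = GIE (G K).1 (G K).2 by case: genK => -[].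
have LE s : D s -> L s = GIE (G (L s)).1 (G (L s)).2 by move=> /genL[[]].
have cK : conic K by rewrite KE; exact: conic_GIE.
have cL s : D s -> conic (L s) by move=> /LE->; exact: conic_GIE.
have Kw : K w.
  rewrite KE; case: wG => -[a aG [c c0 ->]].
  - by apply: conicZ (ltW c0); [exact: conic_GIE|exact: GIE_mem].
  - by apply/GIE_span/rpredZ/memv_span.
have [wcore|ncore] := pselect (core K w); last first.
  have [s Ds ncs] : exists2 s, D s & ~ core (L s) w.
    apply: contrapT => nex; apply: ncore; rewrite KL; apply: core_bigcap => // s Ds.
    by apply: contrapT => ncs; apply: nex; exists s.
  exists s => //; have Lw : L s w by move: Kw; rewrite KL; apply.
  have [[_ fL _] _ _] := genL s Ds.
  by apply: noncore_generated_by_one => //; rewrite -LE.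
suff [s Ds LK] : exists2 s, D s & L s = K by exists s => //; rewrite LK.
have KsubL s : D s -> K `<=` L s by move=> Ds v; rewrite KL; exact.
have KT s : D s -> K = setT -> L s = K.
  by move=> /KsubL KsL KT; apply/seteqP; split=> //; rewrite KT.
(* If the generator is in [(G K).2], then [- w] is in [K] too, and interiority of [w] makes [K] the
   whole space. *)
case: wG => -[a aG [c c0 wE]]; last first.
  exists s0 => //; apply: KT => //; apply: core_full wcore _ => //.
  by rewrite KE; apply: GIE_span; rewrite wE -scaleNr rpredZ // memv_span.
have acore : core K a.
  move=> z; have [t t0 Kt] := wcore (c *: z); exists t => //.
  have := conicZ cK Kt (ltW (divr_gt0 ltr01 c0)).
  rewrite wE div1r scalerDr !scalerA mulVf ?gt_eqF // scale1r mulrCA.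
  by rewrite mulVf ?gt_eqF // mulr1.
have Kn0 : K <> [set 0] by move=> K0; move: Kw; rewrite K0 /= => /eqP; rewrite (negPf w0).
have lwa : <[w]>%VS = <[a]>%VS.
  apply/eqP; rewrite eqEsubv -!memvE wE rpredZ ?memv_line //=.
  by have := memv_line (c *: a); rewrite rpredZeq (gt_eqF c0).
have a0 : a != 0 by apply: contraNneq w0 => a0; rewrite wE a0 scaler0.
rewrite lwa in wn.
have [b [ba Kb KNb]] := core_generator_line genK Kn0 aG acore wn.
(* As [p <= 2], [a] and [b] span the space; since [K] contains the line of [b], it contains every
   point with nonnegative coefficient on [a]. *)
have coord z : exists x y : R, z = x *: a + y *: b.
  have fab : free [:: b; a] by rewrite free_cons span_seq1 ba seq1_free.
  have : z \in <<[:: b; a]>>%VS.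
    rewrite (_ : <<_>>%VS = fullv) ?memvf //; apply/eqP; rewrite eqEdim subvf.
    by rewrite (eqP fab) dimvf dim_matrix mul1r.
  rewrite span_cons span_seq1 => /memv_addP[_ /vlineP[y ->] [_ /vlineP[x ->] ->]].
  by exists x, y; rewrite addrC.
have bline y M : conic M -> M b -> M (- b) -> M (y *: b).
  move=> cM Mb MNb; have [y0|/ltW y0] := leP 0 y; first exact: conicZ.
  by rewrite -[y]opprK scaleNr -scalerN; apply: conicZ; rewrite ?oppr_ge0.
have Ka := core_mem acore.
apply: contrapT => nex.
(* A cone strictly larger than [K] has a point with negative coefficient on [a]; adding a multiple
   of [b] yields [- a], so it is the whole space. If all [L s] are, so is [K]. *)
have LT s : D s -> L s = setT.
  move=> Ds; have [z Lz nKz] : exists2 z, L s z & ~ K z.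
    apply: contrapT => nz; apply: nex; exists s => //; apply/seteqP; split; last exact: KsubL.
    by move=> z Lz; apply: contrapT => nKz; apply: nz; exists z.
  apply: (@core_full _ a); [exact: cL|by apply: core_subset acore; exact: KsubL|].
  have [x [y zE]] := coord z.
  have x0 : x < 0.
    rewrite ltNge; apply/negP => x0; apply: nKz; rewrite zE.
    by apply: conicD => //; [exact: conicZ|exact: bline].
  have -> : - a = (- x)^-1 *: (z + (- y) *: b).
    rewrite zE -addrA -scalerDl subrr scale0r addr0 scalerA invrN mulNr mulVf ?lt_eqF //.
    by rewrite scaleN1r.
  have cLs := cL s Ds.
  apply: conicZ => //; last by rewrite invr_ge0 oppr_ge0 ltW.
  by apply: conicD => //; apply: bline => //; apply: KsubL.
apply: nex; exists s0 => //; apply: KT => //.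
by rewrite KL; apply/seteqP; split=> // v _ s /LT->.
Qed.

End Cones.

(** * Normal cones of polyhedral sets and of their finite unions *)

Section NormalCones.
Variables (R : realType) (p : nat).
Local Notation V := 'rV[R]_p.
Implicit Types (C L : set V) (v w x y z : V).

Lemma dotpC v w : dotp v w = dotp w v.
Proof. by apply: eq_bigr => j _; rewrite mulrC. Qed.

Lemma dotpDr v w z : dotp v (w + z) = dotp v w + dotp v z.
Proof. by rewrite -big_split; apply: eq_bigr => j _; rewrite mxE mulrDr. Qed.

Lemma dotpZr v w (t : R) : dotp v (t *: w) = t * dotp v w.
Proof. by rewrite mulr_sumr; apply: eq_bigr => j _; rewrite mxE mulrCA. Qed.

Lemma dotpBr v w z : dotp v (w - z) = dotp v w - dotp v z.
Proof. by rewrite -scaleN1r dotpDr dotpZr mulN1r. Qed.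

Lemma dotpNl v w : dotp (- v) w = - dotp v w.
Proof. by rewrite dotpC -scaleN1r dotpZr mulN1r dotpC. Qed.

Lemma dotp_le v : exists2 M : R, 0 < M & forall z, dotp v z <= M * `|z|.
Proof.
exists (\sum_j `|v 0 j| + 1) => [|z]; first by rewrite ltr_wpDl // sumr_ge0.
rewrite mulrDl mul1r -[leLHS]addr0 lerD // mulr_suml ler_sum // => j _.
apply: le_trans (ler_norm _) _; rewrite normrM ler_wpM2l //.
by rewrite [leRHS]mx_normrE (le_bigmax _ (fun ij => `|z ij.1 ij.2|) (0, j)).
Qed.

Lemma ball_rV x y (e : R) : ball x e y = (`|y - x| < e) :> Prop.
Proof. by rewrite -ball_normE /= distrC. Qed.

Lemma polyhedral_notin_near C x : polyhedral C -> ~ C x -> \forall y \near x, ~ C y.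
Proof.
move=> [k [A [b ->]]] /existsNP[i /negP]; rewrite -ltNge => bi.
have [M M0 MA] := dotp_le (- A i).
apply/nbhs_ballP; exists ((dotp (A i) x - b i) / M); first by rewrite /= divr_gt0 ?subr_gt0.
move=> y; rewrite ball_rV ltr_pdivlMr // mulrC => yx /(_ i); apply/negP; rewrite -ltNge.
have := le_lt_trans (MA (y - x)) yx.
by rewrite dotpNl dotpBr; lra.
Qed.

Lemma polyhedral_closure C y : polyhedral C ->
  (forall e : R, 0 < e -> exists x, ball y e x /\ C x) -> C y.
Proof.
move=> pC Cy; apply: contrapT => /(polyhedral_notin_near pC) /nbhs_ballP[e /= e0 nC].
by have [x [/nC]] := Cy e e0.
Qed.

Section Inequalities.
Variables (k : nat) (A : 'I_k -> V) (b : 'I_k -> R).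
Let P : set V := [set y | forall i, dotp (A i) y <= b i].

Definition active x : {set 'I_k} := [set i | dotp (A i) x == b i]%SET.

(** Active inequalities do not increase along [z], and inactive ones have slack for a short step. *)
Lemma feasible_direction x z : P x ->
  {in active x, forall i, dotp (A i) z <= 0} ->
  exists2 t : R, 0 < t & forall u, 0 < u <= t -> P (x + u *: z).
Proof.
move=> Px zA.
have [||t t0 Pt] := @uniform_pos R _ (enum 'I_k)
    (fun i t => forall u, 0 < u <= t -> dotp (A i) (x + u *: z) <= b i).
- move=> i t u Pt /andP[_ ut] s /andP[s0 su]; apply: Pt.
  by rewrite s0 (le_trans su).
- move=> i _; have [Ai|nAi] := boolP (i \in active x).
    exists 1 => // u /andP[u0 _]; rewrite dotpDr dotpZr.
    by rewrite -[leRHS]addr0 lerD // mulr_ge0_le0 ?zA // ltW.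
  have bi : dotp (A i) x < b i by rewrite lt_neqAle Px andbT; move: nAi; rewrite inE.
  have [M M0 MA] := dotp_le (A i).
  have z1 : 0 < `|z| + 1 by rewrite ltr_wpDl.
  exists ((b i - dotp (A i) x) / (M * (`|z| + 1))).
    by rewrite divr_gt0 ?mulr_gt0 ?subr_gt0.
  move=> u /andP[u0]; rewrite ler_pdivlMr ?mulr_gt0 // => ub.
  rewrite dotpDr dotpZr -lerBrDl; apply: le_trans ub.
  rewrite ler_wpM2l ?(ltW u0) // (le_trans (MA z)) // ler_wpM2l ?(ltW M0) //.
  by rewrite lerDl.
by exists t => // u ut i; apply: Pt => //; rewrite mem_enum.
Qed.

(** The normal cone is polar to the tangent cone cut out by the active inequalities; conversely,
    [y - x] lies in that tangent cone for each [y] in [P]. *)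
Lemma polyhedral_normalE x v : P x -> regular_normal_cone P x v <->
  forall z, {in active x, forall i, dotp (A i) z <= 0} -> dotp v z <= 0.
Proof.
move=> Px; split=> [[_ vN] z zA|vA].
  rewrite leNgt; apply/negP => vz.
  have z1 : 0 < `|z| + 1 by rewrite ltr_wpDl.
  have [t t0 Pt] := feasible_direction Px zA.
  (* With this tolerance the normality estimate at [x + u *: z] would bound [|z| + 1] by [|z|]. *)
  have /vN : 0 < dotp v z / (`|z| + 1) by rewrite divr_gt0.
  rewrite near_withinE => /nbhs_ballP[e /= e0 ev].
  pose u := Num.min t (e / (`|z| + 1)).
  have u0 : 0 < u by rewrite lt_min t0 divr_gt0.
  have xuz : x + u *: z - x = u *: z by rewrite addrAC subrr add0r.
  have /ev : ball x e (x + u *: z).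
    rewrite ball_rV xuz normrZ gtr0_norm //.
    apply: (@lt_le_trans _ _ (u * (`|z| + 1))); first by rewrite ltr_pM2l // ltrDl.
    by rewrite -ler_pdivlMr // ge_min lexx orbT.
  have /Pt Pu : 0 < u <= t by rewrite u0 ge_min lexx.
  move=> /(_ Pu); rewrite xuz dotpZr normrZ gtr0_norm // mulrCA ler_pM2l //.
  rewrite mulrAC ler_pdivlMr // ler_pM2l //; lra.
split=> // e e0; rewrite near_withinE; apply: nearW => y Py.
apply: (@le_trans _ _ 0); last by rewrite mulr_ge0 // ltW.
by apply: vA => i; rewrite inE => /eqP Ai; rewrite dotpBr Ai subr_le0.
Qed.

(** The polar description sees the point only through its active set, so a polyhedral set has
    finitely many regular normal cones. *)
Lemma polyhedral_normal_active x y : P x -> P y -> active x = active y ->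
  regular_normal_cone P x = regular_normal_cone P y.
Proof.
move=> Px Py xy; apply/seteqP; split=> v /polyhedral_normalE vN;
by apply/polyhedral_normalE => // z zA; apply: vN => //; rewrite ?xy // -xy.
Qed.

End Inequalities.

Lemma polyhedral_normal_closed C x v : polyhedral C -> C x ->
  (forall e : R, 0 < e -> exists2 w, regular_normal_cone C x w & `|w - v| < e) ->
  regular_normal_cone C x v.
Proof.
move=> [k [A [b ->]]] Cx vN; apply/polyhedral_normalE => // z zA.
rewrite leNgt; apply/negP => vz; have [M M0 Mz] := dotp_le (- z).
have [w /polyhedral_normalE -/(_ Cx z zA) wz wv] := vN _ (divr_gt0 vz M0).
have := le_lt_trans (Mz (w - v)) (_ : _ < dotp v z).
rewrite mulrC -ltr_pdivlMr // => /(_ wv).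
by rewrite dotpNl dotpBr ![dotp z _]dotpC; lra.
Qed.

(** Pieces missing [x] stay away from it, and the estimates of the other pieces hold on a common
    neighbourhood. *)
Lemma regular_normal_bigcup (T : finType) (C : T -> set V) x :
  (forall s, polyhedral (C s)) -> (\bigcup_s C s) x ->
  regular_normal_cone (\bigcup_s C s) x =
  [set v | forall s, C s x -> regular_normal_cone (C s) x v].
Proof.
move=> pC Cx; apply/seteqP; split=> v.
  move=> [_ vN] s Csx; split=> // e /vN; rewrite !near_withinE.
  by apply: filterS => y yC Csy; apply: yC; exists s.
move=> vN; split=> // e e0; rewrite near_withinE.
have near_s s : \forall y \near x, C s y -> dotp v (y - x) <= e * `|y - x|.
  have [Csx|nCsx] := pselect (C s x).
    by have [_ /(_ e e0)] := vN s Csx; rewrite near_withinE.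
  by apply: filterS (polyhedral_notin_near (pC s) nCsx).
have := filter_forall (nbhs_filter x) near_s.
by apply: filterS => y yC [s _ Csy]; exact: (yC s).
Qed.

(** Recurrence in every ball stands in for sequences of base points: with finitely many cones
    available, some cone must recur. *)
Definition accumulating_normal_cone C y L : Prop :=
  forall e : R, 0 < e -> exists x, [/\ ball y e x, C x & regular_normal_cone C x = L].

(** The pigeonhole principle is applied to the pieces and then to the active sets of the chosen
    piece. [Q] depends on the radius so as to record improving approximations. *)
Lemma accumulating_normal_coneW (T : finType) (C : T -> set V) y
    (Q : set V -> R -> Prop) :
  (forall s, polyhedral (C s)) -> (forall L t u, Q L t -> t <= u -> Q L u) ->
  (forall e : R, 0 < e -> exists s x,
    [/\ ball y e x, C s x & Q (regular_normal_cone (C s) x) e]) ->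
  exists s L, accumulating_normal_cone (C s) y L /\ forall e, 0 < e -> Q L e.
Proof.
move=> pC Qup yC.
have [|s yCs] := pigeonhole_pos _ yC.
  move=> s t u [x [yx Csx Qx]] tu; exists x; split=> //; last exact: Qup tu.
  exact: le_ball yx.
exists s; have := pC s; move: (C s) yCs => D yD [k [A [b DE]]]; subst D.
have [||I yI] := @pigeonhole_pos R _ (fun (I : {set 'I_k}) e => exists x,
   [/\ ball y e x, [set y0 | forall i, dotp (A i) y0 <= b i] x, active A b x = I
     & Q (regular_normal_cone [set y | forall i, dotp (A i) y <= b i] x) e]).
- move=> I t u [x [yx Dx xI Qx]] tu; exists x; split=> //; last exact: Qup tu.
  exact: le_ball yx.
- by move=> e /yD[x [yx Dx Qx]]; exists (active A b x), x.
have [x [_ Dx xI _]] := yI 1 ltr01.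
exists (regular_normal_cone [set y | forall i, dotp (A i) y <= b i] x).
have xz z : [set y | forall i, dotp (A i) y <= b i] z -> active A b z = I ->
    regular_normal_cone [set y | forall i, dotp (A i) y <= b i] z =
    regular_normal_cone [set y | forall i, dotp (A i) y <= b i] x.
  by move=> Dz zI; apply: polyhedral_normal_active => //; rewrite zI xI.
split=> e /yI[z [yz Dz zI Qz]]; first by exists z; split=> //; exact: xz.
by rewrite -(xz z).
Qed.

(** A vector of a recurring cone is normal at points tending to [y], so a constant sequence of
    normals suffices. *)
Lemma accumulating_normal_cone_limiting C y L : polyhedral C ->
  accumulating_normal_cone C y L -> L `<=` limiting_normal_cone C y.
Proof.
move=> pC yL v Lv; split.
  by apply: polyhedral_closure pC _ => e /yL[x [yx Cx _]]; exists x.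
have /choice[xs xsP] (k : nat) := yL (harmonic k) (harmonic_gt0 k).
exists xs, (fun=> v); split; last exact: cvg_cst.
- by move=> k; have [] := xsP k.
- apply/cvg_ballP => e e0.
  have /cvgrPdist_lt /(_ e e0) : @harmonic R @ \oo --> 0 by exact: cvg_harmonic.
  apply: filterS => k; rewrite sub0r normrN gtr0_norm ?harmonic_gt0 // => /ltW ke.
  by have [yx _ _] := xsP k; exact: le_ball yx.
- by move=> k; have [_ _ ->] := xsP k.
Qed.

End NormalCones.

(** * Selection of a piece and of generators for one multiplier *)

Section PieceSelection.
Variables (R : realType) (gen : generator_choice R).
Hypothesis genP : is_generator_choice gen.
Variables (p r : nat) (C : 'I_r -> set 'rV[R]_p).
Hypothesis polyC : forall s, polyhedral (C s).
Local Notation V := 'rV[R]_p.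
Local Notation vecset := {fset 'rV[R]_p}.
Implicit Types (x y w : V) (L : set V).

Lemma disjunctive_bigcup : disjunctive (\bigcup_s C s).
Proof. by exists r, C. Qed.

Lemma gen_polyhedral s x : C s x ->
  is_generator (regular_normal_cone (C s) x) (gen (regular_normal_cone (C s) x)).
Proof.
move=> Csx; apply: genP => //; exists 1%N, (fun=> C s); split=> //.
by apply/seteqP; split=> [y Csy|y []//]; exists ord0.
Qed.

Lemma accumulating_gens s y L : accumulating_normal_cone (C s) y L ->
  [set` (gen L).1] `<=` gensI gen (C s) y /\ [set` (gen L).2] `<=` gensE gen (C s) y.
Proof.
by move=> yL; split=> a /= aL; near=> e;
  have /yL[x [yx Csx xL]] : 0 < e by []; exists x; split; rewrite ?xL.
Unshelve. all: by end_near. Qed.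

(** The filter only speaks of small radii, but a point found in a small ball also serves a larger
    one. *)
Lemma near_right_ball (C' : set V) y (Q : V -> Prop) :
  (\forall e \near (0 : R)^'+, exists x, [/\ ball y e x, C' x & Q x]) ->
  forall e : R, 0 < e -> exists x, [/\ ball y e x, C' x & Q x].
Proof.
move=> yQ e e0; near (0 : R)^'+ => t.
have [x [yx C'x Qx]] : exists x, [/\ ball y t x, C' x & Q x] by near: t.
by exists x; split=> //; apply: le_ball yx; near: t; exact: nbhs_right_le.
Unshelve. all: by end_near. Qed.

Lemma limiting_normal_accumulating y w :
  limiting_normal_cone (\bigcup_s C s) y w ->
  exists s L, accumulating_normal_cone (C s) y L /\ L w.
Proof.
move=> [_ [xs [vs [Cxs xsy vsN vsw]]]].
(* The second half says that [L] approximates [w] within [e]; the first remembers that [L] is a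
   normal cone of a piece, hence closed, so that [w] is in [L]. *)
pose Q L e := (exists s x, C s x /\ regular_normal_cone (C s) x = L) /\
  exists2 v, L v & `|v - w| < e.
have [|||s [L [yL QL]]] := @accumulating_normal_coneW R p _ C y Q => //.
- move=> L t u [Lx [v Lv vt]] tu; split=> //; exists v => //.
  exact: lt_le_trans tu.
- move=> e e0; near \oo => k.
  have [s _ Csx] := Cxs k.
  exists s, (xs k); split=> //.
    by near: k; exact: (cvg_ball xsy).
  split; first by exists s, (xs k).
  exists (vs k).
    by have := vsN k; rewrite regular_normal_bigcup //; apply.
  by rewrite distrC; near: k; exact: (cvgrPdist_lt _ _).1.
exists s, L; split=> //; have [[t [x [Ctx xL]]] _] := QL 1 ltr01.
rewrite -xL; apply: polyhedral_normal_closed => // e /QL[_]; by rewrite xL.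
Unshelve. all: by end_near. Qed.

Lemma accumulating_selection s y L (AI AE : vecset) :
  accumulating_normal_cone (C s) y L ->
  (AI `<=` (gen L).1)%fset -> (AE `<=` (gen L).2)%fset ->
  [/\ C s y, [set` AI] `<=` gensI gen (C s) y,
    [set` AE] `<=` gensE gen (C s) y
    & GIE AI AE `<=` limiting_normal_cone (C s) y].
Proof.
move=> yL AIL AEL; have [gI gE] := accumulating_gens yL.
have LG : L = GIE (gen L).1 (gen L).2.
  by have [x [_ /gen_polyhedral genL xL]] := yL 1 ltr01; move: genL; rewrite xL => -[[]].
split.
- by apply: polyhedral_closure => // e /yL[x [yx Csx _]]; exists x.
- by move=> a /(fsubsetP AIL); exact: gI.
- by move=> a /(fsubsetP AEL); exact: gE.
apply: subset_trans (accumulating_normal_cone_limiting _ yL) => //.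
by rewrite [X in _ `<=` X]LG; exact: GIE_subset.
Qed.

Lemma piece_selection y w (AI AE : vecset) : (p <= 2)%N -> w != 0 ->
  limiting_normal_cone (\bigcup_s C s) y w ->
  [set` AI] `<=` gensI gen (\bigcup_s C s) y ->
  [set` AE] `<=` gensE gen (\bigcup_s C s) y ->
  free (enum_fset (AI `|` AE)%fset) -> GIE AI AE w ->
  exists s (BI BE : vecset),
    [/\ [/\ C s y, [set` BI] `<=` gensI gen (C s) y
          & [set` BE] `<=` gensE gen (C s) y],
      free (enum_fset (BI `|` BE)%fset), GIE BI BE w,
      GIE BI BE `<=` limiting_normal_cone (C s) y
    & (<<enum_fset (BI `|` BE)%fset>> <= <<enum_fset (AI `|` AE)%fset>>)%VS].
Proof.
move=> p2 w0 wN AIg AEg fA wA.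
(* When the given vectors span the space, the inclusion of spans is automatic, and any recurring
   cone containing [w] will do. *)
have [full|nfull] := eqVneq <<enum_fset (AI `|` AE)%fset>>%VS fullv.
  have [s [L [yL Lw]]] := limiting_normal_accumulating wN.
  have [x [_ /gen_polyhedral]] := yL 1 ltr01; move=> /[swap] -> [[_ fL LE] _ _].
  have := Lw; rewrite {1}LE => /(GIE_free_subset fL)[S [c [v [SL c0 vE wE fS]]]].
  have [Csy SI SE SN] := accumulating_selection yL SL (fsubset_refl _).
  exists s, S, (gen L).2; split=> //; last by rewrite full subvf.
  by rewrite wE; apply: GIE_pos_sum => // a /c0 /ltW.
(* An independent set that does not span has fewer than [p] vectors, hence exactly one, as [w] is
   nonzero. *)
have [a Aa] : exists a, (AI `|` AE)%fset = [fset a]%fset.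
  have dA := eqP fA.
  have ltp : (#|` (AI `|` AE)%fset| < p)%N.
    rewrite ltnNge; apply: contra nfull => lep; rewrite eqEdim subvf dA dimvf.
    by rewrite dim_matrix mul1r.
  have : (#|` (AI `|` AE)%fset| <= 1)%N by rewrite -ltnS (leq_trans ltp).
  rewrite leq_eqVlt ltnS leqn0 => /orP[/cardfs1P//|/eqP A0].
  have := GIE_sub_span wA; rewrite (_ : <<_>>%VS = 0%VS) ?memv0 ?(negPf w0) //.
  by apply/eqP; rewrite -dimv_eq0 dA A0.
have aP b : b \in AI \/ b \in AE -> b = a.
  move=> Ab; have : b \in (AI `|` AE)%fset by rewrite inE; apply/orP.
  by rewrite Aa inE => /eqP.
have [k wE] : exists k, w = k *: a.
  by have := GIE_sub_span wA; rewrite Aa fset1_seq span_seq1 => /vlineP.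
have k0 : k != 0 by apply: contraNneq w0 => k0; rewrite wE k0 scale0r.
have wa : <[w]>%VS = <[a]>%VS.
  apply/eqP; rewrite eqEsubv -!memvE wE rpredZ ?memv_line //=.
  by have := memv_line (k *: a); rewrite rpredZeq (negPf k0).
have wspan : <[w]>%VS = <<enum_fset (AI `|` AE)%fset>>%VS.
  by rewrite Aa fset1_seq span_seq1.
(* [a] is a generator for the union at points arbitrarily near [y]. From [AE] any nonzero multiple
   is allowed; from [AI] the coefficient is positive because [w] is a nonzero element of the
   generated cone. *)
have yw (e : R) : 0 < e -> exists x, [/\ ball y e x, (\bigcup_s C s) x
    & generated_by_one (gen (regular_normal_cone (\bigcup_s C s) x)) w].
  move=> e0; have [aE|naE] := boolP (a \in AE).
    have [x [yx Cx ax]] := near_right_ball (AEg a aE) e0.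
    by exists x; split=> //; right; exists a => //; exists k.
  have AE0 : AE = fset0.
    by apply/fsetP => b; rewrite inE; apply/negP => bE; move: naE; rewrite -(aP b) ?bE //;
      right.
  have AIa : AI = [fset a]%fset by rewrite -Aa AE0 fsetU0.
  have [x [yx Cx ax]] : exists x, [/\ ball y e x, (\bigcup_s C s) x
      & a \in (gen (regular_normal_cone (\bigcup_s C s) x)).1].
    by apply: near_right_ball e0; apply: AIg; rewrite /= AIa inE.
  exists x; split=> //; left; exists a => //.
  have := wA; rewrite AIa AE0 => -[_ [v [[c c0 ->]]]].
  rewrite big_seq_fset1 fset0_seq span_nil memv0 => /eqP-> ; rewrite addr0 => wca.
  exists (c a) => //; rewrite lt_neqAle c0 andbT eq_sym.
  by apply: contraNneq w0 => ca0; rewrite wca ca0 scale0r.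
(* At each nearby point the property passes from the union to some piece; then one piece and one
   cone recur. *)
have [||s [L [yL wL]]] := @accumulating_normal_coneW R p _ C y
    (fun L _ => generated_by_one (gen L) w) polyC => //.
  move=> e /yw[x [yx Cx wx]].
  have [||||| s Csx ws] := @generated_by_one_bigcap R p _ (fun s => C s x)
      (fun s => regular_normal_cone (C s) x) _ (@gen p) w p2 _ _ _ _ w0 _ wx.
  - by have [s _ Csx] := Cx; exists s.
  - exact: regular_normal_bigcup.
  - by apply: genP => //; exact: disjunctive_bigcup.
  - by move=> s; exact: gen_polyhedral.
  - by rewrite wspan.
  by exists s, x.
have {wL} [wL|wL] := wL 1 ltr01.
- have [b bL [c c0 wb]] := wL.
  have bS : ([fset b] `<=` (gen L).1)%fset by rewrite fsub1set.
  have [Csy SI SE SN] := accumulating_selection yL bS (fsub0set _).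
  exists s, [fset b]%fset, fset0; split=> //.
  + by rewrite fsetU0 fset1_seq seq1_free; apply: contraNneq w0 => b0; rewrite wb b0 scaler0.
  + by rewrite wb; apply: (conicZ (@conic_GIE _ _ _ _)) (ltW c0); apply: GIE_mem; rewrite inE.
  + rewrite fsetU0 fset1_seq span_seq1 -wspan -memvE.
    by have := memv_line w; rewrite {1}wb rpredZeq (gt_eqF c0).
- have [b bL [c c0 wb]] := wL.
  have bS : ([fset b] `<=` (gen L).2)%fset by rewrite fsub1set.
  have [Csy SI SE SN] := accumulating_selection yL (fsub0set _) bS.
  exists s, fset0, [fset b]%fset; split=> //.
  + by rewrite fset0U fset1_seq seq1_free; apply: contraNneq w0 => b0; rewrite wb b0 scaler0.
  + by apply: GIE_span; rewrite wb rpredZ // memv_span // inE.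
  + rewrite fset0U fset1_seq span_seq1 -wspan -memvE.
    by have := memv_line w; rewrite {1}wb rpredZeq (negPf c0).
Qed.

End PieceSelection.

(** * Passage from the subsystems to the whole system *)

Theorem theorem4p3 (R : realType) (gen : generator_choice R)
    (hgen : is_generator_choice gen)
    (d n m l p r : nat) (hp : (p <= 2)%N)
    (C : 'I_r -> set 'rV[R]_p) (hC : forall s, polyhedral (C s))
    (g : 'rV[R]_d -> 'rV[R]_n) (hg : locally_lipschitz g)
    (h : 'rV[R]_d -> 'rV[R]_m) (hh : smooth h)
    (Phi : 'I_l -> 'rV[R]_d -> 'rV[R]_p) (hPhi : forall i, smooth (Phi i))
    (x : 'rV[R]_d)
    (hx : solution g h Phi (fun=> \bigcup_s C s) x) :
  MPDC_PRCPLD gen g h Phi C x ->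
  MPDC_RCPLD gen g h Phi (fun=> \bigcup_s C s) x.
Proof.
move=> prcpld; have [gx hx0 Phix] := hx; split.
  (* The rank condition is the same for all subsystems, so any pieces through the points [Phi i x]
     yield it. *)
  have /choice[s sP] i : exists s, C s (Phi i x).
    by have [s _ Csx] := Phix i; exists s.
  by have [] := prcpld s (And3 gx hx0 sP).
move=> J basJ I lh lg eta v gI nz lhJ lgI lg0 vg etaN zero xs vs AI AE xsx xsn
  vsg vsv AIg AEg etaA eta0A.
have /choice[B BP] i : exists B : 'I_r * ({fset 'rV[R]_p} * {fset 'rV[R]_p}),
    [/\ C B.1 (Phi i x) /\ limiting_normal_cone (C B.1) (Phi i x) (eta i),
      [set` B.2.1] `<=` gensI gen (C B.1) (Phi i x) /\
        [set` B.2.2] `<=` gensE gen (C B.1) (Phi i x),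
      eta i != 0 -> [/\ free (enum_fset (B.2.1 `|` B.2.2)%fset),
         GIE B.2.1 B.2.2 (eta i)
       & GIE B.2.1 B.2.2 `<=` limiting_normal_cone (C B.1) (Phi i x)],
      eta i = 0 -> (B.2.1 `|` B.2.2 = fset0)%fset
    & (<<enum_fset (B.2.1 `|` B.2.2)%fset>> <= <<enum_fset (AI i `|` AE i)%fset>>)%VS].
  (* For a zero multiplier any piece through [Phi i x] serves, with no generators; constant
     sequences show that 0 is a limiting normal. *)
  have [e0|en0] := eqVneq (eta i) 0.
    have [s _ Csx] := Phix i; exists (s, (fset0, fset0)); rewrite fsetU0 fset0_seq.
    split=> //=; last by rewrite span_nil sub0v.
    split=> //; rewrite e0; split=> //; exists (fun=> Phi i x), (fun=> 0).
    split=> // [|k|]; [exact: cvg_cst| |exact: cvg_cst].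
    split=> // e epos; rewrite near_withinE; apply: nearW => y _.
    rewrite /dotp big1 ?mulr_ge0 ?(ltW epos) // => j _; by rewrite mxE mul0r.
  have [fA GA _] := etaA i en0.
  have [s [BI [BE [[Cs gBI gBE] fB GB BN sB]]]] :=
    piece_selection hgen hC hp en0 (etaN i) (AIg i) (AEg i) fA GA.
  exists (s, (BI, BE)); split=> //=; first by split=> //; exact: BN.
  by move=> e0; rewrite e0 eqxx in en0.
(* The chosen pieces define a partition whose subsystem [x] solves. *)
have solB : solution g h Phi (fun i => C (B i).1) x.
  by split=> // i; have [[]] := BP i.
have [_ /(_ J basJ I lh lg eta v gI nz lhJ lgI lg0 vg) rcpld] := prcpld _ solB.
have := rcpld _ zero xs vs (fun i => (B i).2.1) (fun i => (B i).2.2) xsx xsn vsg vsv.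
move=> /(_ (fun i => ltac:(by have [[_ etaB]] := BP i))).
move=> /(_ (fun i => ltac:(by have [_ [gB _]] := BP i))).
move=> /(_ (fun i => ltac:(by have [_ [_ gB]] := BP i))).
move=> /(_ (fun i => ltac:(by have [_ _ etaB] := BP i))).
move=> /(_ (fun i => ltac:(by have [_ _ _ etaB] := BP i))).
(* For each [k], independence of the original family would give independence of the one for the
   chosen pieces. *)
apply: filterS => k; apply: contra.
apply: rcpld_family_subspan => i; last by have [] := BP i.
have [_ _ fB eB _] := BP i; have [e0|/fB[]//] := eqVneq (eta i) 0.
by rewrite eB // fset0_seq nil_free.
Qed.
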